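(* Let $R$ be the endomorphism ring of an elliptic curve, let $H$ be a finite subgroup of $GL(2,R)$ with $$H\cap SL(2,R)=\{I_2\},$$ and let $h_o\in H$ be an element of order $r$ with $\det(H)=\langle\det(h_o)\rangle\simeq C_s$, $s>1$, and eigenvalues $\lambda_1(h_o),\lambda_2(h_o)$. Then $r=s$ and $H$ is isomorphic to $H_{C1}(j)\simeq C_{s_j}$ for some $1\leq j\leq4$, where $$H_{C1}(1)=\langle h_o\rangle\simeq C_2\ \text{ with }\ \lambda_1(h_o)=1,\ \lambda_2(h_o)=-1,$$ $$H_{C1}(2)=\langle h_o\rangle\simeq C_3\ \text{ with }\ R=\mathcal{O}_{-3},\ h_o=e^{-\frac{2\pi i}{3}}I_2\ \text{ or }\ \lambda_1(h_o)=e^{\frac{2\pi i}{3}},\ \lambda_2(h_o)=1,$$ $$H_{C1}(3)=\langle h_o\rangle\simeq C_4\ \text{ with }\ R=\mathbb{Z}[i],\ \{\lambda_1(h_o),\lambda_2(h_o)\}=\{i,1\}\ \text{ or }\ \{-i,-1\},$$ $$H_{C1}(4)=\langle h_o\rangle\simeq C_6\ \text{ with }\ R=\mathcal{O}_{-3},\ \{\lambda_1(h_o),\lambda_2(h_o)\}=\{e^{\frac{\pi i}{3}},1\},\ \{e^{-\frac{2\pi i}{3}},-1\}\ \text{ or }\ \{e^{\frac{2\pi i}{3}},e^{-\frac{\pi i}{3}}\}.$$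
   Context: $R=\mathrm{End}(E)$ for a complex elliptic curve $E$; thus $R=\mathbb{Z}$ or $R=\mathbb{Z}+f\mathcal{O}_{-d}\subset\mathbb{C}$ with $f\in\mathbb{N}$ and $\mathcal{O}_{-d}$ the integers ring of an imaginary quadratic field $\mathbb{Q}(\sqrt{-d})$. $GL(2,R)=\{g\in R_{2\times2}:\det(g)\in R^*\}$, $SL(2,R)$ is its subgroup of matrices of determinant $1$, and $C_n$ is the cyclic group of order $n$. In the list, $h_o$ denotes some generator, in $GL(2,R)$, of the listed group with the indicated properties; ''with $R=\dots$'' means that the case is listed only for that ring $R$. *)

(* Defs.v *)
From HB Require Import structures.
From mathcomp Require Import all_boot all_order all_algebra.
From mathcomp Require Import complex.
From mathcomp Require Import boolp classical_sets functions cardinality.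
From mathcomp Require Import reals trigo.

Set Implicit Arguments.
Unset Strict Implicit.
Unset Printing Implicit Defensive.

Import Order.TTheory GRing.Theory Num.Theory.

Local Open Scope classical_set_scope.
Local Open Scope ring_scope.
Local Open Scope complex_scope.

Definition set_isog (T U : Type) (opT : T -> T -> T) (opU : U -> U -> U)
    (A : set T) (B : set U) : Prop :=
  exists f : T -> U, set_bij A B f /\
    (forall x y, A x -> A y -> f (opT x y) = opU (f x) (f y)).

Definition cyc (A : unitRingType) (x : A) : set A := range (fun n : int => x ^ n).

(* [Zp n] is the additive group of integers modulo n, also when n = 1. *)
Definition isog_C (A : unitRingType) (G : set A) (n : nat) : Prop :=
  set_isog *%R +%R G [set` Zp n].

Definition has_order (A : unitRingType) (x : A) (n : nat) : Prop :=
  [/\ (0 < n)%N, x ^+ n = 1 & forall k, (0 < k < n)%N -> x ^+ k <> 1].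

Definition is_subgroup (A : unitRingType) (G : set A) : Prop :=
  [/\ G 1, forall x y, G x -> G y -> G (x * y) & forall x, G x -> G x^-1].

(* The curve is the complex torus C / (Z period1 + Z period2). *)
Record elliptic_curve (K : realType) := EllipticCurve {
  period1 : K[i];
  period2 : K[i];
  periods_free : forall a b : K,
    a%:C * period1 + b%:C * period2 = 0 -> a = 0 /\ b = 0
}.

Definition period_lattice (K : realType) (E : elliptic_curve K) : set K[i] :=
  [set z | exists m n : int, z = m%:~R * period1 E + n%:~R * period2 E].

(* Every endomorphism of C / L is induced by the multiplication by a unique
   complex number a with a L contained in L; this embeds the endomorphism
   ring in C. *)
Definition endRing (K : realType) (E : elliptic_curve K) : set K[i] :=
  [set a | forall z, period_lattice E z -> period_lattice E (a * z)].

(* Q(sqrt(-d)), and below its ring of integers O_{-d}. *)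
Definition imag_quad_field (K : realType) (d : nat) : set K[i] :=
  [set z | exists a b : rat, z = ratr a + ratr b * sqrtC (- d%:R)].

Definition ring_of_integers (K : realType) (d : nat) : set K[i] :=
  [set z | @imag_quad_field K d z /\ integralOver (intr : int -> K[i]) z].

Definition gaussian_integers (K : realType) : set K[i] :=
  [set z | exists a b : int, z = a%:~R + b%:~R * 'i%C].

Arguments imag_quad_field : clear implicits.
Arguments ring_of_integers : clear implicits.
Arguments gaussian_integers : clear implicits.

Definition is_unit_of (K : realType) (R : set K[i]) (x : K[i]) : Prop :=
  R x /\ exists2 y, R y & x * y = 1.

Definition GL2 (K : realType) (R : set K[i]) : set 'M[K[i]]_2 :=
  [set g : 'M[K[i]]_2 | (forall i j, R (g i j)) /\ is_unit_of R (\det g)].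

Definition SL2 (K : realType) (R : set K[i]) : set 'M[K[i]]_2 :=
  [set g : 'M[K[i]]_2 | GL2 R g /\ \det g = 1].

(* [l1] and [l2] are the eigenvalues of [g], with multiplicity. *)
Definition eigenvalues (K : realType) (g : 'M[K[i]]_2) (l1 l2 : K[i]) : Prop :=
  char_poly g = ('X - l1%:P) * ('X - l2%:P).

(* e^{i t} *)
Definition expi (K : realType) (t : K) : K[i] := cos t +i* sin t.

Definition sC1 (j : nat) : nat := nth 0 [:: 2; 3; 4; 6]%N j.-1.

Definition HC1_spec (K : realType) (R : set K[i]) (j : nat) (h : 'M[K[i]]_2)
    : Prop :=
  match j with
  | 1 => eigenvalues h 1 (-1)
  | 2 => R = ring_of_integers K 3 /\
         (h = (expi (- (2 * pi / 3)))%:M \/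
          eigenvalues h (expi (2 * pi / 3)) 1)
  | 3 => R = gaussian_integers K /\
         (eigenvalues h 'i%C 1 \/ eigenvalues h (- 'i%C) (-1))
  | 4 => R = ring_of_integers K 3 /\
         [\/ eigenvalues h (expi (pi / 3)) 1,
             eigenvalues h (expi (- (2 * pi / 3))) (-1) |
             eigenvalues h (expi (2 * pi / 3)) (expi (- (pi / 3)))]
  | _ => False
  end.

(* [cyc h] is a group H_C1(j) of the list, with [h] as distinguished
   generator. *)
Definition HC1 (K : realType) (R : set K[i]) (j : nat) (h : 'M[K[i]]_2) : Prop :=
  [/\ GL2 R h, isog_C (cyc h) (sC1 j) & HC1_spec R j h].

(* Main.v *)
Require Import Defs.
From HB Require Import structures.
From mathcomp Require Import all_boot all_order all_algebra.
From mathcomp Require Import algC algnum.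
From mathcomp Require Import complex.
From mathcomp Require Import boolp classical_sets functions cardinality.
From mathcomp Require Import reals trigo.
From mathcomp Require Import zify ring lra.

Set Implicit Arguments.
Unset Strict Implicit.
Unset Printing Implicit Defensive.

Import Order.TTheory GRing.Theory Num.Theory.

Local Open Scope classical_set_scope.
Local Open Scope ring_scope.
Local Open Scope complex_scope.

(** Since no element of [H] other than the identity has determinant 1, the
    determinant embeds [H] into the units of the endomorphism ring [R]. Its image
    is generated by [det ho], so [H] is the cyclic group generated by [ho], and
    the orders of [ho] and [det ho] agree: this gives [r = s].

    An endomorphism acts on the period lattice by an integer 2 x 2 matrix, so
    every element of [R] is a root of a monic integer quadratic polynomial
    ([endRing_quadratic]). For a root of unity [d] that is not real this
    polynomial is X^2 - tX + 1 with t = d + conj d an integer strictly between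
    -2 and 2, whence [s] is 2, 3, 4 or 6 ([root_of_unity_order]).
    When [s > 2], the ring [R] contains a non-real element [w] of the quadratic
    field and therefore lies in Q(w) ([endRing_span]); it consists of integral
    elements, and the Gaussian and Eisenstein integers already contain all the
    integral elements of their fields, so [R] is Z[i] or O_{-3}
    ([endRing_gaussian], [endRing_eisenstein]).

    Replacing [ho] by its inverse if needed, one gets a generator [h] of [H]
    whose determinant is exactly [d] = exp(2 pi i / s) ([det_generator]). The
    eigenvalues of [h] are s-th roots of unity, that is, powers [d ^ i] and [d ^ j], and their
    product is [d], so i + j = 1 modulo s ([eigenvalues_prim]). Up to order the
    pairs (i, j) are (0,1) for s = 2; (0,1), (2,2) for s = 3; (0,1), (2,3) for
    s = 4; and (0,1), (2,5), (3,4) for s = 6, which is the announced list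
    ([HC1_of_det]). In the case (2,2) the matrix is scalar because it has
    finite order, hence is diagonalizable ([scalar_of_double_eigenvalue]). *)

(** * Maximality of the Gaussian and Eisenstein integers *)

Lemma quadratic_integral (F : numFieldType) (z : F) (t n : int) :
  z ^+ 2 = t%:~R * z - n%:~R -> integralOver (intr : int -> F) z.
Proof.
move=> zE; exists ('X^2 + (n%:P - t *: 'X)).
  rewrite monicE lead_coefDl ?lead_coefXn // size_polyXn.
  rewrite (leq_ltn_trans (size_polyD _ _)) // gtn_max size_polyN.
  rewrite (leq_ltn_trans (size_polyC_leq1 _)) //.
  by rewrite (leq_ltn_trans (size_scale_leq _ _)) ?size_polyX.
rewrite rmorphD rmorphB /= map_polyXn map_polyC map_polyZ map_polyX /=.
rewrite /root !(hornerD, hornerN, hornerZ, hornerX, hornerXn, hornerC) zE.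
by apply/eqP; ring.
Qed.

Lemma integral_conj (C : numClosedFieldType) (z : C) :
  integralOver (intr : int -> C) z ->
  integralOver (intr : int -> C) (Num.conj z).
Proof.
case=> p p_monic pz; exists p => //.
have -> : map_poly intr p = map_poly (@Num.conj C) (map_poly intr p).
  by rewrite -map_poly_comp; apply: eq_map_poly => k /=; rewrite rmorph_int.
by rewrite rmorph_root.
Qed.

(** The rational root theorem, that Z is integrally closed in Q, transported
    from the algebraic numbers. *)
Lemma integral_ratr_int (F : numFieldType) (q : rat) :
  integralOver (intr : int -> F) (ratr q) -> exists n : int, q = n%:~R.
Proof.
case=> p p_monic pq.
have ratr_intr (L : numFieldType) :
    map_poly (intr : int -> L) p =
    map_poly ratr (map_poly (intr : int -> rat) p).
  by rewrite -map_poly_comp; apply: eq_map_poly => k /=; rewrite ratr_int.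
have pq' : root (map_poly (intr : int -> algC) p) (ratr q).
  by rewrite ratr_intr fmorph_root; rewrite ratr_intr fmorph_root in pq.
have /Cint_rat_Aint : (ratr q : algC) \in Crat by exact: Crat_rat.
case/(_ _)/intrP; last first.
  by move=> n; rewrite -ratr_int => /fmorph_inj ->; exists n.
apply: root_monic_Aint pq' _ _; first exact: monic_map.
by apply/polyOverP => k; rewrite coef_map /= intr_int.
Qed.

Lemma sqr_int_rat (q : rat) (k : int) :
  q ^+ 2 = k%:~R -> exists n : int, q = n%:~R.
Proof.
move=> qk; apply: (@integral_ratr_int algC).
apply: (@quadratic_integral _ _ 0 (- k)).
by rewrite -rmorphXn /= qk ratr_int; ring.
Qed.

(** The trace 2a and the norm a^2 + D b^2 of an integral element of
    Q(sqrt(-D)) are integral, since the conjugate is integral too, and rational,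
    hence integers. *)
Lemma integral_imag_quad (C : numClosedFieldType) (w : C) (D : nat)
    (a b : rat) :
  w ^+ 2 = - D%:R -> (0 < D)%N ->
  integralOver (intr : int -> C) (ratr a + ratr b * w) ->
  exists m N : int, a = m%:~R / 2 /\ a ^+ 2 + D%:R * b ^+ 2 = N%:~R.
Proof.
move=> w2 D_gt0 z_int.
(* w is purely imaginary because w^2 is negative: |w|^2 = |w^2| = D = - w^2. *)
have wJ : Num.conj w = - w.
  have w0 : w != 0 by rewrite -sqrf_eq0 w2 oppr_eq0 pnatr_eq0 -lt0n.
  apply: (mulfI w0); rewrite -normCK -normrX w2 normrN normr_nat.
  by rewrite mulrN -expr2 w2 opprK.
have ratJ q : Num.conj (ratr q : C) = ratr q.
  by rewrite fmorph_rat.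
have zJ : integralOver (intr : int -> C) (ratr a + ratr b * - w).
  have <- : Num.conj (ratr a + ratr b * w) = ratr a + ratr b * - w.
    by rewrite rmorphD [X in _ + X]rmorphM /= ratJ wJ ratJ.
  exact: integral_conj.
have [m mE] : exists m : int, a *+ 2 = m%:~R.
  apply: (@integral_ratr_int C).
  suff -> : ratr (a *+ 2) = ratr a + ratr b * w + (ratr a + ratr b * - w) :> C.
    exact: integral_add z_int zJ.
  by rewrite rmorphMn /=; ring.
have [N NE] : exists N : int, a ^+ 2 + D%:R * b ^+ 2 = N%:~R.
  apply: (@integral_ratr_int C).
  suff -> : ratr (a ^+ 2 + D%:R * b ^+ 2) =
     (ratr a + ratr b * w) * (ratr a + ratr b * - w) :> C.
    exact: integral_mul z_int zJ.
  rewrite rmorphD [X in _ + X]rmorphM !rmorphXn /= ratr_nat.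
  rewrite -[D%:R]opprK -w2; ring.
by exists m, N; split => //; rewrite -mE; field.
Qed.

Lemma int_parity (m : int) : exists k : int, m = 2 * k \/ m = 2 * k + 1.
Proof. by exists (m %/ 2)%Z; lia. Qed.

(** Squares are 0 or 1 modulo 4. *)
Lemma sum_sqr_even (m c N : int) : m ^+ 2 + c ^+ 2 = 4 * N ->
  exists m' c' : int, m = 2 * m' /\ c = 2 * c'.
Proof.
have [[m' mE] [c' cE]] := (int_parity m, int_parity c).
rewrite !expr2 => mcN; exists m', c'.
by case: mE cE => [] mE [] cE; rewrite mE cE in mcN *; lia.
Qed.

(** Squares are 0 or 1 modulo 3. *)
Lemma sqr_dvd3 (c X : int) : c ^+ 2 = 3 * X -> exists n : int, c = 3 * n.
Proof.
have cE : c = 3 * (c %/ 3)%Z + (c %% 3)%Z by lia.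
have : (c %% 3)%Z = 0 \/ (c %% 3)%Z = 1 \/ (c %% 3)%Z = 2 by lia.
move: cE; move: (c %/ 3)%Z (c %% 3)%Z => q r -> rE; rewrite expr2 => sq.
by exists q; case: rE sq => [|[|]] ->; lia.
Qed.

Lemma sum_sqr3_parity (m n N : int) : m ^+ 2 + 3 * n ^+ 2 = 4 * N ->
  exists k : int, m = n + 2 * k.
Proof.
have [[m' mE] [n' nE]] := (int_parity m, int_parity n).
rewrite !expr2 => mnN; exists (m' - n').
by case: mE nE => [] mE [] nE; rewrite mE nE in mnN *; lia.
Qed.

(** With m = 2a and c = 2b, the norm equation reads m^2 + c^2 = 4N, which
    forces [m] and [c] to be even. *)
Lemma gaussian_maximal (C : numClosedFieldType) (w : C) (a b : rat) :
  w ^+ 2 = - 1 ->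
  integralOver (intr : int -> C) (ratr a + ratr b * w) ->
  exists m n : int, ratr a + ratr b * w = m%:~R + n%:~R * w.
Proof.
move=> w2 /(@integral_imag_quad _ _ 1 _ _ w2 isT) [m [N [aE NE]]].
have [c cE] : exists c : int, 2 * b = c%:~R.
  apply: (@sqr_int_rat _ (4 * N - m ^+ 2)).
  have -> : (4 * N - m ^+ 2)%:~R = 4 * N%:~R - m%:~R ^+ 2 :> rat by ring.
  by rewrite -NE aE; field.
have mcN : m ^+ 2 + c ^+ 2 = 4 * N.
  apply: (@intr_inj rat).
  have -> : (4 * N)%:~R = 4 * N%:~R :> rat by ring.
  have -> : (m ^+ 2 + c ^+ 2)%:~R = m%:~R ^+ 2 + c%:~R ^+ 2 :> rat by ring.
  by rewrite -NE -cE aE; field.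
have [m' [c' [mE c'E]]] := sum_sqr_even mcN.
exists m', c'.
have -> : a = m'%:~R by rewrite aE mE rmorphM /=; field.
have -> : b = c'%:~R.
  apply: (@mulfI _ (2 : rat)) => //; rewrite cE c'E rmorphM /=; ring.
by rewrite !ratr_int.
Qed.

(** With m = 2a, the norm equation makes (6b)^2 = 3(4N - m^2) an integer; so
    6b is an integer divisible by 3, and n = 2b satisfies m^2 + 3n^2 = 4N, whence
    [m] and [n] have the same parity. *)
Lemma eisenstein_maximal (C : numClosedFieldType) (w : C) (a b : rat) :
  w ^+ 2 = - 3%:R ->
  integralOver (intr : int -> C) (ratr a + ratr b * w) ->
  exists m n : int, ratr a + ratr b * w = m%:~R + n%:~R * ((1 + w) / 2).
Proof.
move=> w2 /(@integral_imag_quad _ _ 3 _ _ w2 isT) [m [N [aE NE]]].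
have [c cE] : exists c : int, 6 * b = c%:~R.
  apply: (@sqr_int_rat _ (3 * (4 * N - m ^+ 2))).
  have -> : (3 * (4 * N - m ^+ 2))%:~R =
    3 * (4 * N%:~R - m%:~R ^+ 2) :> rat by ring.
  by rewrite -NE aE; field.
have cN : c ^+ 2 = 3 * (4 * N - m ^+ 2).
  apply: (@intr_inj rat).
  have -> : (3 * (4 * N - m ^+ 2))%:~R =
    3 * (4 * N%:~R - m%:~R ^+ 2) :> rat by ring.
  by rewrite rmorphXn /= -NE -cE aE; field.
have [n nE] := sqr_dvd3 cN.
have mnN : m ^+ 2 + 3 * n ^+ 2 = 4 * N.
  by move: cN; rewrite nE !expr2; lia.
have [k kE] := sum_sqr3_parity mnN.
exists k, n.
have -> : a = k%:~R + n%:~R / 2 by rewrite aE kE rmorphD rmorphM /=; field.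
have -> : b = n%:~R / 2.
  by apply: (@mulfI _ (6 : rat)) => //; rewrite cE nE rmorphM /=; field.
have half : ratr (n%:~R / 2) = n%:~R / 2 :> C.
  rewrite (fmorph_div (ratr : {rmorphism rat -> C})) /=.
  by rewrite ratr_int ratr_nat.
rewrite rmorphD /= half ratr_int.
by field.
Qed.

(** * Endomorphism rings of complex tori *)

Section EndomorphismRing.
Variables (K : realType) (E : elliptic_curve K).
Local Notation R := (endRing E).
Local Notation p1 := (period1 E).
Local Notation p2 := (period2 E).

Lemma endRing_int (k : int) : R k%:~R.
Proof.
move=> z [m [n ->]]; exists (k * m), (k * n); ring.
Qed.

Lemma endRingD x y : R x -> R y -> R (x + y).
Proof.
move=> Rx Ry z Lz; have [m [n xz]] := Rx z Lz; have [m' [n' yz]] := Ry z Lz.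
exists (m + m'), (n + n'); rewrite mulrDl xz yz; ring.
Qed.

Lemma endRingM x y : R x -> R y -> R (x * y).
Proof. by move=> Rx Ry z Lz; rewrite -mulrA; apply/Rx/Ry. Qed.

Lemma period1_neq0 : p1 != 0.
Proof.
apply/eqP => p10; have [] := @periods_free K E 1 0.
  by rewrite p10 mulr0 raddf0 mul0r addr0.
by move=> /eqP; rewrite oner_eq0.
Qed.

Lemma endRing_period1 a : R a ->
  exists m n : int, a * p1 = m%:~R * p1 + n%:~R * p2.
Proof. by apply; exists 1, 0; ring. Qed.

Lemma endRing_period2 a : R a ->
  exists m n : int, a * p2 = m%:~R * p1 + n%:~R * p2.
Proof. by apply; exists 0, 1; ring. Qed.

(** Cayley-Hamilton for the integer matrix of [a] acting on the two
    periods. *)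
Lemma endRing_quadratic a : R a ->
  exists t n : int, a ^+ 2 = t%:~R * a - n%:~R.
Proof.
move=> Ra; have [m [n a1]] := endRing_period1 Ra.
have [m' [n' a2]] := endRing_period2 Ra.
exists (m + n'), (m * n' - n * m'); apply: (mulIf period1_neq0).
have -> : a ^+ 2 * p1 = m%:~R * (a * p1) + n%:~R * (a * p2).
  by rewrite expr2 -mulrA {1}a1; ring.
have -> : ((m + n')%:~R * a - (m * n' - n * m')%:~R) * p1 =
    m%:~R * (a * p1) + n'%:~R * (a * p1) - (m * n' - n * m')%:~R * p1 by ring.
by rewrite a2 a1; ring.
Qed.

Lemma endRing_integral a : R a -> integralOver (intr : int -> K[i]) a.
Proof.
by move=> /endRing_quadratic [t [n a2]]; apply: quadratic_integral a2.
Qed.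

(** If [w] sends [p1] to m p1 + n p2, then [n] is nonzero, for otherwise
    w = m; hence p2 is in Q(w) p1, and so is z p1. *)
Lemma endRing_span w z : R w -> (forall k : int, w <> k%:~R) -> R z ->
  exists a b : rat, z = ratr a + ratr b * w.
Proof.
move=> Rw w_nint Rz; have [m [n w1]] := endRing_period1 Rw.
have [m' [n' z1]] := endRing_period1 Rz.
have n0 : n%:~R != 0 :> K[i].
  apply/eqP => n0; apply: (w_nint m); apply: (mulIf period1_neq0).
  by rewrite w1 n0; ring.
have nq : n%:~R != 0 :> rat by move: n0; rewrite !intr_eq0.
exists ((n * m' - n' * m)%:~R / n%:~R), (n'%:~R / n%:~R).
have divE (k l : int) : ratr (k%:~R / l%:~R) = k%:~R / l%:~R :> K[i].
  by rewrite (fmorph_div (ratr : {rmorphism rat -> K[i]})) /= !ratr_int.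
rewrite !divE; apply: (mulIf period1_neq0); apply: (mulfI n0).
have -> : n%:~R * (z * p1) = n%:~R * m'%:~R * p1 + n'%:~R * (n%:~R * p2).
  by rewrite z1; ring.
have -> : n%:~R * p2 = w * p1 - m%:~R * p1 by rewrite w1; ring.
by field.
Qed.

(** The form in which the maximality of the Gaussian and Eisenstein integers
    applies to the endomorphism ring. *)
Lemma endRing_maximal w z : R w -> (forall k : int, w <> k%:~R) -> R z ->
  exists a b : rat, z = ratr a + ratr b * w /\
    integralOver (intr : int -> K[i]) (ratr a + ratr b * w).
Proof.
move=> Rw w_nint Rz; have [a [b zE]] := endRing_span Rw w_nint Rz.
by exists a, b; split=> //; rewrite -zE; apply: endRing_integral.
Qed.

Lemma sqr_neg_nint (w : K[i]) (D : nat) : (0 < D)%N -> w ^+ 2 = - D%:R ->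
  forall k : int, w <> k%:~R.
Proof.
move=> D_gt0 w2 k wk; have := sqr_ge0 k.
have : k ^+ 2 = - D%:Z.
  by apply: (@intr_inj K[i]); rewrite rmorphXn /= -wk w2 mulrNz.
by move=> ->; rewrite oppr_ge0; lia.
Qed.

Lemma endRing_gaussian : R 'i%C -> R = gaussian_integers K.
Proof.
move=> Ri; have i2 : 'i%C ^+ 2 = - 1 :> K[i] by exact: sqr_i.
apply/seteqP; split=> [z Rz|z [a [b ->]]]; last first.
  by apply/endRingD/endRingM/Ri; apply: endRing_int.
have [a [b [-> z_int]]] :=
  endRing_maximal Ri (@sqr_neg_nint _ 1 isT i2) Rz.
exact: gaussian_maximal.
Qed.

(** A primitive cube root of unity [w] gives the square root 1 + 2w of -3,
    which is, up to sign, the one that defines the quadratic field. *)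
Lemma endRing_eisenstein w : R w -> w ^+ 2 + w + 1 = 0 ->
  R = ring_of_integers K 3.
Proof.
move=> Rw w_root; set u := sqrtC (- 3%:R : K[i]).
have u2 : u ^+ 2 = - 3%:R by exact: sqrtCK.
have v2 : (1 + 2 * w) ^+ 2 = - 3%:R.
  rewrite [LHS](_ : _ = 4 * (w ^+ 2 + w + 1) - 3%:R); last by ring.
  by rewrite w_root; ring.
have Rv : R (1 + 2 * w).
  have -> : 1 + 2 * w = 1%:~R + 2%:~R * w by ring.
  exact: endRingD (endRing_int 1) (endRingM (endRing_int 2) Rw).
(* The sign e depends on which cube root of unity w is. *)
have [e [e2 uE]] : exists e : int, e ^+ 2 = 1 /\ u = e%:~R * (1 + 2 * w).
  have /eqP : u ^+ 2 = (1 + 2 * w) ^+ 2 by rewrite u2 v2.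
  by rewrite eqf_sqr => /orP[]/eqP ->; [exists 1|exists (-1)];
    split=> //; ring.
apply/seteqP; split=> [z Rz|z [[a [b ->]] z_int]]; last first.
  have [m [n ->]] := eisenstein_maximal u2 z_int.
  have [k ek] : exists k, e = 2 * k + 1.
    move: e2; rewrite expr2 => e2.
    have [k [ek|]] := int_parity e; last by exists k.
    by rewrite ek in e2; lia.
  have -> : (1 + u) / 2 = (1 + k)%:~R + e%:~R * w.
    by rewrite uE ek; field.
  apply: endRingD (endRing_int m) (endRingM (endRing_int n) _).
  exact: endRingD (endRing_int (1 + k)) (endRingM (endRing_int e) Rw).
have [a [b [-> z_int]]] := endRing_maximal Rv (@sqr_neg_nint _ 3 isT v2) Rz.
split=> //; exists a, (b * e%:~R).
have e1 : e%:~R * e%:~R = 1 :> K[i] by rewrite -expr2 -rmorphXn e2.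
have <- : e%:~R * u = 1 + 2 * w by rewrite uE mulrA e1 mul1r.
by rewrite rmorphM /= ratr_int mulrA.
Qed.

End EndomorphismRing.

(** * Roots of unity in quadratic orders *)

Lemma expiD (K : realType) (a b : K) : expi (a + b) = expi a * expi b.
Proof.
apply/eqP; rewrite eq_complex /= cosD sinD.
by apply/andP; split; apply/eqP; ring.
Qed.

Lemma expi0 (K : realType) : expi (0 : K) = 1.
Proof. by rewrite /expi cos0 sin0. Qed.

Lemma expiN (K : realType) (a : K) : expi (- a) = (expi a)^-1.
Proof. by apply/esym/mulr1_eq; rewrite -expiD subrr expi0. Qed.

(** exp(i pi / 3) is a root of X^3 + 1 with positive imaginary part, hence
    different from -1; the other factor of X^3 + 1 therefore vanishes. *)
Lemma expi_pi3_root (K : realType) :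
  expi (pi / 3) ^+ 2 - expi (pi / 3) + 1 = 0 :> K[i].
Proof.
have z3 : expi (pi / 3) ^+ 3 = -1 :> K[i].
  rewrite exprS expr2 -!expiD.
  have -> : pi / 3 + (pi / 3 + pi / 3) = pi :> K by field.
  by apply/eqP; rewrite eq_complex /= cospi sinpi oppr0 !eqxx.
have z1 : expi (pi / 3) + 1 != 0 :> K[i].
  rewrite eq_complex /= addr0 negb_and; apply/orP; right.
  rewrite gt_eqF // sin_gt0_pi //.
  have := pi_gt0 K; lra.
apply: (mulfI z1); rewrite mulr0.
by rewrite -[RHS](addNr 1) -z3; ring.
Qed.

Lemma expi_2pi3 (K : realType) : expi (2 * pi / 3) = expi (pi / 3) ^+ 2 :> K[i].
Proof. by rewrite expr2 -expiD; congr expi; field. Qed.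

(** A non-real root of unity [d] and its conjugate are the two roots of
    the integer polynomial of [d], so that its trace t is d + conj d and its
    norm is 1. Then |t| <= 2, and t = 2 or t = -2 would make [d] equal to 1 or -1; the
    traces -1, 0 and 1 give the orders 3, 4 and 6. *)
Lemma root_of_unity_order (K : realType) (E : elliptic_curve K) (d : K[i])
    (s : nat) :
  endRing E d -> (1 < s)%N -> s.-primitive_root d ->
  [\/ s = 2%N /\ d = -1, s = 3%N /\ d ^+ 2 + d + 1 = 0,
      s = 4%N /\ d ^+ 2 = -1 | s = 6%N /\ d ^+ 2 - d + 1 = 0].
Proof.
move=> Rd s_gt1 d_prim.
have s_gt0 := prim_order_gt0 d_prim.
have ordP n : d ^+ n = 1 -> (s %| n)%N.
  by move/eqP; rewrite (prim_order_dvd d_prim).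
have ds := prim_expr_order d_prim.
have d_norm : `|d| = 1.
  by apply/eqP; rewrite -(pexpr_eq1 (n := s)) ?normr_ge0 // -normrX ds normr1.
have ddJ : d * Num.conj d = 1 by rewrite -normCK d_norm expr1n.
have [d2|d2] := eqVneq (d ^+ 2) 1.
  have s2 : s = 2%N.
    have := ordP _ d2; have := s_gt1.
    by move: (s) => [|[|[|?]]] // _ /dvdn_leq; lia.
  apply: Or41; split=> //; move/eqP: d2; rewrite sqrf_eq1 => /orP[]/eqP // d1.
  by have := ordP 1%N; rewrite d1 expr1n dvdn1 => /(_ erefl); lia.
have d_nreal : d - Num.conj d != 0.
  by apply: contra_neq d2 => /subr0_eq dJ; rewrite -ddJ -dJ.
have [t [n dE]] := endRing_quadratic Rd.
have tE : t%:~R = d + Num.conj d.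
  have dJE : Num.conj d ^+ 2 = t%:~R * Num.conj d - n%:~R.
    by rewrite -rmorphXn dE rmorphB rmorphM /= !rmorph_int.
  (* Subtract the two quadratic equations satisfied by d and conj d. *)
  apply: (mulfI d_nreal).
  rewrite [RHS](_ : _ = d ^+ 2 - Num.conj d ^+ 2); last by ring.
  by rewrite dE dJE; ring.
have {}dE : d ^+ 2 = t%:~R * d - 1 by rewrite tE -ddJ; ring.
have t_le2 : `|t| <= 2.
  rewrite -(ler_int K[i]) intr_norm tE (le_trans (ler_normD _ _)) //.
  by rewrite norm_conjC d_norm.
have t_ne2 e : e ^+ 2 = 1 -> t != 2 * e.
  move=> e2; apply/eqP => te; case/eqP: d2.
  have /eqP : (d - e%:~R) ^+ 2 = 0.
    have e2C : e%:~R ^+ 2 = 1 :> K[i] by rewrite -rmorphXn e2.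
    by rewrite sqrrB dE te e2C; ring.
  by rewrite sqrf_eq0 subr_eq0 => /eqP ->; rewrite -rmorphXn e2.
have {t_le2} : [\/ t = -1, t = 0 | t = 1].
  have /eqP := t_ne2 1 erefl; have /eqP := t_ne2 (-1) erefl.
  have : t = -2 \/ t = -1 \/ t = 0 \/ t = 1 \/ t = 2 by lia.
  by case=> [|[|[|[|]]]] -> //; [constructor 1|constructor 2|constructor 3].
case=> te; rewrite te in dE.
- have dq : d ^+ 2 + d + 1 = 0 by rewrite dE; ring.
  apply: Or42; split=> //.
  have d3 : d ^+ 3 = 1.
    apply/subr0_eq; have -> : d ^+ 3 - 1 = (d - 1) * (d ^+ 2 + d + 1) by ring.
    by rewrite dq mulr0.
  have := @dvdn_leq s 3 isT (ordP _ d3); have := ordP _ d3; move: s_gt1 d2 ds.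
  by move: (s) => [|[|[|[|]]]] //= .
- have dq : d ^+ 2 = -1 by rewrite dE; ring.
  have d4 : d ^+ 4 = 1 by rewrite -[4%N]/(2 * 2)%N exprM dq sqrrN expr1n.
  apply: Or43; split=> //.
  have := @dvdn_leq s 4 isT (ordP _ d4); have := ordP _ d4; move: s_gt1 d2 ds.
  by move: (s) => [|[|[|[|[|]]]]] //= _ /eqP.
- have dq : d ^+ 2 - d + 1 = 0 by rewrite dE; ring.
  have d3 : d ^+ 3 = -1.
    apply/subr0_eq; have -> : d ^+ 3 - -1 = (d + 1) * (d ^+ 2 - d + 1) by ring.
    by rewrite dq mulr0.
  have d6 : d ^+ 6 = 1 by rewrite -[6%N]/(3 * 2)%N exprM d3 sqrrN expr1n.
  apply: Or44; split=> //.
  have := @dvdn_leq s 6 isT (ordP _ d6); have := ordP _ d6; move: s_gt1 d2 ds.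
  move: (s) => [|[|[|[|[|[|[|]]]]]]] //= _ /eqP // _.
  rewrite d3 => /eqP; rewrite eqNr oner_eq0 //.
Qed.

Lemma prim_root_orderP (F : fieldType) (x : F) (s : nat) : (0 < s)%N ->
  x ^+ s = 1 -> (forall n, x ^+ n = 1 -> (s %| n)%N) -> s.-primitive_root x.
Proof.
move=> s_gt0 xs ordP; have [m xm ms] := prim_order_exists s_gt0 xs.
by have <- : m = s by apply/eqP; rewrite eqn_dvd ms ordP ?prim_expr_order.
Qed.

Lemma prim_rootV (F : fieldType) (x : F) (s : nat) :
  s.-primitive_root x -> s.-primitive_root x^-1.
Proof.
move=> x_prim; apply: prim_root_orderP.
- exact: prim_order_gt0 x_prim.
- by rewrite exprVn (prim_expr_order x_prim) invr1.
- by move=> n /eqP; rewrite exprVn invr_eq1 (prim_order_dvd x_prim).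
Qed.

(** * Eigenvalues of a matrix of finite order *)

Lemma eigenvalues_sym (K : realType) (h : 'M[K[i]]_2) (a b : K[i]) :
  eigenvalues h a b -> eigenvalues h b a.
Proof. by rewrite /eigenvalues mulrC. Qed.

Lemma eigenvalues_exist (K : realType) (h : 'M[K[i]]_2) :
  exists a b, eigenvalues h a b.
Proof.
have [rs] := closed_field_poly_normal (char_poly h).
rewrite (monicP (char_poly_monic h)) scale1r => hE.
have := size_char_poly h; rewrite hE size_prod_XsubC => -[].
case: rs hE => [|a [|b []]] // hE _; exists a, b.
by rewrite /eigenvalues hE big_cons big_seq1.
Qed.

Lemma eigenvalues_det (K : realType) (h : 'M[K[i]]_2) (a b : K[i]) :
  eigenvalues h a b -> \det h = a * b.
Proof.
move=> hE; have := char_poly_det h; rewrite hE sqrrN expr1n mul1r => <-.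
by rewrite -horner_coef0 !hornerE; ring.
Qed.

Lemma eigenvalue_expr1 (K : realType) (h : 'M[K[i]]_2) (a : K[i]) (n : nat) :
  root (char_poly h) a -> h ^+ n = 1 -> a ^+ n = 1.
Proof.
rewrite -eigenvalue_root_char => /eigenvalueP [v vh v0] hn.
have vhn k : v *m h ^+ k = a ^+ k *: v.
  elim: k => [|k IHk]; first by rewrite !expr0 mulmx1 scale1r.
  by rewrite exprS mulmxA vh -scalemxAl IHk scalerA -exprS.
have /eqP : (a ^+ n - 1) *: v = 0.
  by rewrite scalerBl scale1r -vhn hn mulmx1 subrr.
by rewrite scaler_eq0 (negPf v0) orbF subr_eq0 => /eqP.
Qed.

(** Write h = a + N; then N^2 = 0 by Cayley-Hamilton, so that
    h^n = a^n + n a^(n-1) N. As h^n = 1 = a^n in characteristic 0, [N]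
    vanishes. *)
Lemma scalar_of_double_eigenvalue (K : realType) (h : 'M[K[i]]_2) (a : K[i])
    (n : nat) :
  (0 < n)%N -> eigenvalues h a a -> h ^+ n = 1 -> h = a%:M.
Proof.
move=> n_gt0 hE hn.
have an : a ^+ n = 1.
  by apply: eigenvalue_expr1 hn; rewrite hE rootM root_XsubC eqxx.
have a0 : a != 0.
  apply: contra_eq_neq an => ->.
  by rewrite expr0n gtn_eqF // eq_sym oner_eq0.
have [N [hNa N2]] : exists N, h = a%:M + N /\ N * N = 0.
  exists (h - a%:M); split; first by rewrite addrC subrK.
  have := Cayley_Hamilton h.
  by rewrite hE rmorphM rmorphB /= horner_mx_X horner_mx_C.
have hk k : h ^+ k.+1 = (a ^+ k.+1)%:M + (a ^+ k *+ k.+1) *: N.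
  elim: k => [|k IHk]; first by rewrite expr1 {1}hNa expr0 scale1r.
  have cN c : c%:M * N = c *: N by rewrite -mulmxE mul_scalar_mx.
  have Nc c : N * c%:M = c *: N by rewrite -mulmxE mul_mx_scalar.
  rewrite exprSr IHk {1}hNa mulrDl !mulrDr -!scalerAl N2 scaler0 addr0 cN Nc.
  rewrite -[_%:M * _%:M]scalar_mxM -exprSr -addrA scalerA -scalerDl.
  by rewrite [in RHS]mulrS mulrnAl -exprSr.
case: n n_gt0 hn an => // n _; rewrite hk => hn an.
have /eqP : (a ^+ n *+ n.+1) *: N = 0.
  by apply: (addrI 1%:M); rewrite addr0 -{1}an hn.
rewrite scaler_eq0 mulrn_eq0 /= expf_eq0 (negPf a0) andbF /= => /eqP N0.
by rewrite hNa N0 addr0.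
Qed.

(** Both eigenvalues are s-th roots of unity, hence powers of the primitive
    one [\det h], and their product is [\det h] itself. *)
Lemma eigenvalues_prim (K : realType) (h : 'M[K[i]]_2) (s : nat) :
  s.-primitive_root (\det h) -> h ^+ s = 1 ->
  exists i j : nat, [/\ (i <= j < s)%N, i + j = 1 %[mod s]
    & eigenvalues h (\det h ^+ i) (\det h ^+ j)].
Proof.
move=> d_prim hs; have [a [b hE]] := eigenvalues_exist h.
have ab := eigenvalues_det hE.
have as1 : a ^+ s = 1.
  by apply: eigenvalue_expr1 hs; rewrite hE rootM !root_XsubC eqxx.
have bs1 : b ^+ s = 1.
  by apply: eigenvalue_expr1 hs; rewrite hE rootM !root_XsubC eqxx orbT.
have [i aE] := prim_rootP d_prim as1; have [j bE] := prim_rootP d_prim bs1.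
have ij : i + j = 1 %[mod s].
  by apply/eqP; rewrite -(eq_prim_root_expr d_prim) exprD -aE -bE -ab expr1.
rewrite aE bE in hE.
have [le_ij|lt_ji] := leqP i j; first by exists i, j; rewrite le_ij ltn_ord.
exists j, i; rewrite (ltnW lt_ji) ltn_ord addnC; split=> //.
exact: eigenvalues_sym.
Qed.

(** * The group generated by one matrix *)

Lemma cycV (A : unitRingType) (x : A) : cyc x^-1 = cyc x.
Proof.
apply/seteqP; split=> _ [n _ <-]; exists (- n) => //; last first.
  by rewrite exprz_inv opprK.
by rewrite -exprz_inv.
Qed.

(** An isomorphism [f] with the integers modulo [s] gives x^s = 1 because
    f (x^s) = s (f x) = 0. If x^n = 1, then y^n = 1 for the [y] with f y = 1, so
    that n = f (y^n) = 0 modulo s. *)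
Lemma isog_C_prim_root (F : fieldType) (x : F) (s : nat) : x != 0 ->
  (1 < s)%N -> isog_C (cyc x) s -> s.-primitive_root x.
Proof.
move=> x0 s_gt1 [f [f_bij fM]].
have xU : x \is a GRing.unit by rewrite unitfE.
have cyc1 : cyc x 1 by exists 0.
have cycM y z : cyc x y -> cyc x z -> cyc x (y * z).
  by move=> [m _ <-] [n _ <-]; exists (m + n) => //; rewrite exprzDr.
have f1 : f 1 = 0 by apply: (addrI (f 1)); rewrite -fM // mulr1 addr0.
have cycX y n : cyc x y -> cyc x (y ^+ n).
  by move=> Cy; elim: n => // n IHn; rewrite exprS; apply: cycM.
have fX y n : cyc x y -> f (y ^+ n) = f y *+ n.
  move=> Cy; elim: n => [|n IHn]; first by rewrite expr0 f1.
  by rewrite exprS fM ?IHn -?mulrS //; apply: cycX.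
have s0 : s%:R = 0 :> 'Z_s by apply/ord_inj; rewrite val_Zp_nat // modnn.
have Cx : cyc x x by exists 1.
apply: prim_root_orderP; first exact: ltnW.
  apply: (set_bij_inj f_bij); rewrite ?inE //; first exact: cycX.
  by rewrite fX // f1 -mulr_natr s0 mulr0.
move=> n xn.
have [y Cy fy] : exists2 y, cyc x y & f y = 1.
  by apply: (set_bij_surj f_bij); rewrite /= /Zp s_gt1 inE.
have yn : y ^+ n = 1.
  by have [k _ <-] := Cy; rewrite exprnP exprzAC -exprnP xn exp1rz.
have := fX _ n Cy; rewrite yn f1 fy => /(congr1 (@nat_of_ord _))/=.
by rewrite val_Zp_nat // => /esym/eqP.
Qed.

Lemma det_expz (F : fieldType) (n' : nat) (h : 'M[F]_n'.+1) (n : int) :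
  \det (h ^ n) = \det h ^ n.
Proof.
have detX k : \det (h ^+ k) = \det h ^+ k.
  by elim: k => [|k IHk]; rewrite ?expr0 ?det1 // !exprS det_mulmx IHk.
case: n => n; first exact: detX.
by rewrite !NegzE -!exprnN detV detX.
Qed.

(** The pairs of exponents i <= j < s with i + j = 1 modulo s are exactly the
    entries of the list, once the powers of exp(2 pi i / s) are named. *)
Lemma HC1_of_det (K : realType) (E : elliptic_curve K) (h : 'M[K[i]]_2)
    (s : nat) :
  GL2 (endRing E) h -> isog_C (cyc h) s -> s.-primitive_root (\det h) ->
  h ^+ s = 1 ->
  [\/ s = 2%N /\ \det h = -1, s = 3%N /\ \det h = expi (2 * pi / 3),
      s = 4%N /\ \det h = 'i%C | s = 6%N /\ \det h = expi (pi / 3)] ->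
  exists2 j : nat, (1 <= j <= 4)%N & HC1 (endRing E) j h.
Proof.
move=> hGL hC d_prim hs cases.
have Rd : endRing E (\det h) by case: hGL => _ [].
have [i [j [/andP[le_ij lt_js] ij hE]]] := eigenvalues_prim d_prim hs.
have zR := expi_pi3_root K.
have ds := prim_expr_order d_prim.
case: cases => -[sE dE]; subst s; rewrite dE in hE Rd ds.
- exists 1%N => //; split=> //=.
  have [iE jE] : (i = 0 /\ j = 1)%N by lia.
  by rewrite iE jE in hE.
- exists 2%N => //; split=> //=; split.
    apply: endRing_eisenstein Rd _; rewrite expi_2pi3.
    set z := expi (pi / 3) in zR *.
    have -> : (z ^+ 2) ^+ 2 + z ^+ 2 + 1 =
      (z ^+ 2 - z + 1) * (z ^+ 2 + z + 1) by ring.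
    by rewrite zR mul0r.
  have [[iE jE]|[iE jE]] : (i = 0 /\ j = 1 \/ i = 2 /\ j = 2)%N by lia.
    by right; rewrite iE jE in hE; apply: eigenvalues_sym.
  left; rewrite expiN (mulr1_eq (y := expi (2 * pi / 3) ^+ 2)) -?exprS //.
  by rewrite iE jE in hE; apply: scalar_of_double_eigenvalue hE hs.
- exists 3%N => //; split=> //=; split; first exact: endRing_gaussian.
  have [[iE jE]|[iE jE]] : (i = 0 /\ j = 1 \/ i = 2 /\ j = 3)%N by lia.
    by left; rewrite iE jE in hE; apply: eigenvalues_sym.
  have i3 : 'i%C ^+ 3 = - 'i%C :> K[i] by rewrite exprS sqr_i mulrN1.
  by right; rewrite iE jE i3 sqr_i in hE; apply: eigenvalues_sym.
- exists 4%N => //; split=> //=; split.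
    apply: endRing_eisenstein (endRingM Rd Rd) _.
    set z := expi (pi / 3) in zR *.
    have -> : (z * z) ^+ 2 + z * z + 1 =
      (z ^+ 2 - z + 1) * (z ^+ 2 + z + 1) by ring.
    by rewrite zR mul0r.
  have -> : expi (- (2 * pi / 3)) = expi (pi / 3) ^+ 4 :> K[i].
    by rewrite expiN expi_2pi3; apply: mulr1_eq; rewrite -exprD.
  have -> : expi (- (pi / 3)) = expi (pi / 3) ^+ 5 :> K[i].
    by rewrite expiN; apply: mulr1_eq; rewrite -exprS.
  have <- : expi (pi / 3) ^+ 3 = -1 :> K[i].
    set z := expi (pi / 3) in zR *; apply/subr0_eq.
    have -> : z ^+ 3 - -1 = (z + 1) * (z ^+ 2 - z + 1) by ring.
    by rewrite zR mulr0.
  rewrite expi_2pi3.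
  have [[iE jE]|[[iE jE]|[iE jE]]] :
    (i = 0 /\ j = 1 \/ i = 2 /\ j = 5 \/ i = 3 /\ j = 4)%N by lia.
  + by constructor 1; rewrite iE jE in hE; apply: eigenvalues_sym.
  + by constructor 3; rewrite iE jE in hE.
  + by constructor 2; rewrite iE jE in hE; apply: eigenvalues_sym.
Qed.

(** A quadratic cyclotomic polynomial has the two inverse roots c and 1/c,
    with c = exp(2 pi i / s), and -1 is its own inverse. *)
Lemma det_generator (K : realType) (E : elliptic_curve K) (d : K[i]) (s : nat) :
  endRing E d -> (1 < s)%N -> s.-primitive_root d ->
  exists2 c, c = d \/ c = d^-1 &
  [\/ s = 2%N /\ c = -1, s = 3%N /\ c = expi (2 * pi / 3),
      s = 4%N /\ c = 'i%C | s = 6%N /\ c = expi (pi / 3)].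
Proof.
have zR := expi_pi3_root K; set z := expi (pi / 3) in zR *.
move=> Rd s_gt1 /(root_of_unity_order Rd s_gt1) [] [sE dE].
- by exists d; [left|constructor 1].
- have : (d - z ^+ 2) * (d * z ^+ 2 - 1) = 0.
    have -> : (d - z ^+ 2) * (d * z ^+ 2 - 1) =
      z ^+ 2 * (d ^+ 2 + d + 1)
      - d * ((z ^+ 2 - z + 1) * (z ^+ 2 + z + 1)) by ring.
    by rewrite zR dE mul0r !mulr0 subr0.
  move=> /eqP; rewrite mulf_eq0 !subr_eq0 => dz.
  exists (expi (2 * pi / 3)); last by constructor 2.
  rewrite expi_2pi3 -/z; case/orP: dz => /eqP dz; first by left.
  by right; rewrite (mulr1_eq dz).
- have /eqP : d ^+ 2 = 'i%C ^+ 2 by rewrite dE sqr_i.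
  rewrite eqf_sqr => dz; exists 'i%C; last by constructor 3.
  case/orP: dz => /eqP dz; [by left|right].
  by apply/esym/mulr1_eq; rewrite dz mulNr -expr2 sqr_i opprK.
- have : (d - z) * (d * z - 1) = 0.
    have -> : (d - z) * (d * z - 1) =
      z * (d ^+ 2 - d + 1) - d * (z ^+ 2 - z + 1) by ring.
    by rewrite zR dE !mulr0 subr0.
  move=> /eqP; rewrite mulf_eq0 !subr_eq0 => dz.
  exists z; last by constructor 4.
  case/orP: dz => /eqP dz; first by left.
  by right; rewrite (mulr1_eq dz).
Qed.

Theorem proposition30 (K : realType) (E : elliptic_curve K)
    (H : set 'M[K[i]]_2) (ho : 'M[K[i]]_2) (l1 l2 : K[i]) (r s : nat)
    (Hgrp : is_subgroup H) (HGL : H `<=` GL2 (endRing E)) (Hfin : finite_set H)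
    (HSL : H `&` SL2 (endRing E) = [set 1%:M])
    (Hho : H ho) (ho_order : has_order ho r)
    (detH : (fun g : 'M[K[i]]_2 => \det g) @` H = cyc (\det ho))
    (detHs : isog_C (cyc (\det ho)) s) (s_gt1 : (1 < s)%N)
    (ho_eig : eigenvalues ho l1 l2) :
  r = s /\
  exists (j : nat) (h : 'M[K[i]]_2),
    [/\ (1 <= j <= 4)%N, HC1 (endRing E) j h, H h
      & set_isog *%R *%R H (cyc h)].
Proof.
have [H1 HM HV] := Hgrp.
have det0 g : H g -> \det g != 0.
  move=> /HGL [_ [_ [y _ gy]]]; apply: contra_eq_neq gy => ->.
  by rewrite mul0r eq_sym oner_eq0.
have HU g : H g -> g \is a GRing.unit.
  by move=> Hg; rewrite -[_ \is a _]/(g \in unitmx) unitmxE unitfE det0.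
have det1_eq1 g : H g -> \det g = 1 -> g = 1.
  move=> Hg g1; have : (H `&` SL2 (endRing E)) g.
    by split=> //; split=> //; apply: HGL.
  by rewrite HSL.
have det_inj g g' : H g -> H g' -> \det g = \det g' -> g = g'.
  move=> Hg Hg' gg'; rewrite -[g](mulrVK (HU g' Hg')) [g / g']det1_eq1 ?mul1r //.
    exact/HM/HV.
  by rewrite det_mulmx detV gg' divff ?det0.
have HX g n : H g -> H (g ^+ n).
  by move=> Hg; elim: n => [|n IHn]; rewrite ?expr0 // exprS; apply: HM.
have HXz g (n : int) : H g -> H (g ^ n).
  by case: n => n Hg; [apply: HX|rewrite NegzE -exprnN; apply/HV/HX].
have H_cyc : H = cyc ho.
  apply/seteqP; split=> [g Hg|_ [n _ <-]]; last exact: HXz.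
  have : cyc (\det ho) (\det g) by rewrite -detH; exists g.
  case=> n _ gE; exists n => //.
  by apply: det_inj; rewrite ?det_expz //; apply: HXz.
have d_prim := isog_C_prim_root (det0 _ Hho) s_gt1 detHs.
have hos : ho ^+ s = 1.
  apply: det1_eq1; first exact: HX.
  by rewrite exprnP det_expz -exprnP (prim_expr_order d_prim).
have rs : r = s.
  have [r_gt0 hor r_min] := ho_order.
  apply/eqP; rewrite eqn_leq; apply/andP; split.
    rewrite leqNgt; apply/negP => lt_sr; apply: (r_min s) hos.
    by rewrite lt_sr ltnW.
  apply: dvdn_leq => //; rewrite (prim_order_dvd d_prim).
  by rewrite exprnP -det_expz -exprnP hor det1.
split=> //.
have Rd : endRing E (\det ho) by case: (HGL _ Hho) => _ [].
have [c cE cases] := det_generator Rd s_gt1 d_prim.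
have [h [Hh hE dE]] : exists h, [/\ H h, H = cyc h & \det h = c].
  case: cE => ->; first by exists ho.
  by exists ho^-1; rewrite cycV detV; split=> //; apply: HV.
have isogH : isog_C (cyc h) s.
  rewrite -hE; have [f [f_bij fM]] := detHs.
  exists (f \o (fun g : 'M[K[i]]_2 => \det g)); split.
    apply: set_bij_comp f_bij; rewrite -detH; apply: inj_bij => g g' /[!inE].
    exact: det_inj.
  move=> g g' Hg Hg' /=; rewrite det_mulmx fM // -detH; first by exists g.
  by exists g'.
have h_prim : s.-primitive_root (\det h).
  by rewrite dE; case: cE => ->; last exact: prim_rootV.
have hs : h ^+ s = 1.
  apply: det1_eq1; first exact: HX.
  by rewrite exprnP det_expz -exprnP (prim_expr_order h_prim).
rewrite -dE in cases.
have [j j_le hj] := HC1_of_det (HGL _ Hh) isogH h_prim hs cases.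
exists j, h; split=> //; rewrite -hE; exists id; split=> //.
by have := @inj_bij _ _ H id (fun _ _ _ _ => id); rewrite image_id.
Qed.
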